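(* A matroid $M$ is laminar if and only if, for all circuits $C_1$ and $C_2$ of $M$ with $C_1\cap C_2\neq\emptyset$, either $\mathrm{cl}(C_1)\subseteq \mathrm{cl}(C_2)$ or $\mathrm{cl}(C_2)\subseteq \mathrm{cl}(C_1)$.
   Context: All matroids are finite; $\mathrm{cl}$ denotes the closure operator of $M$. A family $\mathcal{A}$ of subsets of a finite set $E$ is laminar if, for all $A,B\in\mathcal{A}$ with $A\cap B\neq\emptyset$, either $A\subseteq B$ or $B\subseteq A$. Given a laminar family $\mathcal{A}$ of subsets of $E$ and a capacity function $c:\mathcal{A}\to\mathbb{Z}_{\ge 0}$, $M(E,\mathcal{A},c)$ is the matroid on $E$ whose independent sets are exactly the sets $I\subseteq E$ with $|I\cap A|\le c(A)$ for all $A\in\mathcal{A}$. A matroid is laminar if it is isomorphic to $M(E,\mathcal{A},c)$ for some finite set $E$, laminar family $\mathcal{A}$ of subsets of $E$, and capacity function $c$. *)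

(* Defs.v *)
From mathcomp Require Import all_boot.

Set Implicit Arguments.
Unset Strict Implicit.
Unset Printing Implicit Defensive.

Record matroid (E : finType) := Matroid {
  indep : pred {set E};
  indep0 : indep set0;
  indep_sub : forall I J : {set E}, J \subset I -> indep I -> indep J;
  indep_augment : forall I J : {set E}, indep I -> indep J -> #|I| < #|J| ->
    exists2 e, e \in J :\: I & indep (e |: I)
}.

Definition circuit (E : finType) (M : matroid E) (C : {set E}) : bool :=
  minset (fun X : {set E} => ~~ indep M X) C.

Definition rank (E : finType) (M : matroid E) (X : {set E}) : nat :=
  \max_(I : {set E} | (I \subset X) && indep M I) #|I|.

Definition cl (E : finType) (M : matroid E) (X : {set E}) : {set E} :=
  [set e | rank M (e |: X) == rank M X].

Definition matroid_iso (E E' : finType) (M : matroid E) (M' : matroid E')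
    : Prop :=
  exists2 f : E -> E', bijective f &
    forall I : {set E}, indep M I = indep M' (f @: I).

Definition laminar_family (E : finType) (F : {set {set E}}) : Prop :=
  forall A B : {set E}, A \in F -> B \in F -> A :&: B != set0 ->
    A \subset B \/ B \subset A.

Section LaminarMatroid.

Variables (E : finType) (F : {set {set E}}) (c : {set E} -> nat).

(* Only the values of the capacity [c] on members of [F] are used. *)
Definition laminar_indep (I : {set E}) : bool :=
  [forall A in F, #|I :&: A| <= c A].

Hypothesis lamF : laminar_family F.

Lemma laminar_indep0 : laminar_indep set0.
Proof. by apply/forall_inP => A _; rewrite set0I cards0. Qed.

Lemma laminar_indep_sub (I J : {set E}) :
  J \subset I -> laminar_indep I -> laminar_indep J.
Proof.
move=> sJI /forall_inP iI; apply/forall_inP => A FA.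
exact: leq_trans (subset_leq_card (setSI A sJI)) (iI A FA).
Qed.

Lemma laminar_cover_card (I J : {set E}) (G : {set {set E}}) :
  G \subset F -> (forall A, A \in G -> #|J :&: A| <= #|I :&: A|) ->
  #|J :&: cover G| <= #|I :&: cover G|.
Proof.
have [n] := ubnP #|G|; elim: n G => // n IHn G leGn sGF leJI.
have [trG | /trivIsetP ntrG] := boolP (trivIset G).
  have cardE K : #|K :&: cover G| = \sum_(A in G) #|K :&: A|.
    transitivity (\sum_(x in cover G) (x \in K : nat)).
      rewrite -sum1_card big_mkcond [RHS]big_mkcond /=.
      by apply: eq_bigr => x _; rewrite inE; do 2!case: (x \in _).
    rewrite big_trivIset //=; apply: eq_bigr => A _.
    rewrite -sum1_card big_mkcond [RHS]big_mkcond /=.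
    by apply: eq_bigr => x _; rewrite inE; do 2!case: (x \in _).
  by rewrite !cardE; apply: leq_sum.
have [A [B [GA GB neAB sAB]]] : exists A B : {set E},
    [/\ A \in G, B \in G, A != B & A \subset B].
  have /existsP[A /existsP[B /and4P[GA GB neAB meetAB]]] :
      [exists A, exists B, [&& A \in G, B \in G, A != B
                             & ~~ [disjoint A & B]]].
    apply: contraT => /existsPn noAB; case: ntrG => A B GA GB neAB.
    by have /existsPn/(_ B) := noAB A; rewrite GA GB neAB /= negbK.
  have [] := lamF (subsetP sGF _ GA) (subsetP sGF _ GB).
  - by rewrite setI_eq0.
  - by exists A, B.
  - by exists B, A; rewrite eq_sym.
have coverG : cover G = cover (G :\ A).
  apply/eqP; rewrite eqEsubset; apply/andP; split; apply/bigcupsP => X.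
    have [-> _ | neXA GX] := eqVneq X A.
      by apply: subset_trans sAB (bigcup_sup B _); rewrite !inE eq_sym neAB.
    by apply: bigcup_sup; rewrite !inE neXA.
  by rewrite inE => /andP[_ GX]; apply: bigcup_sup.
rewrite coverG; apply: IHn.
- by rewrite (cardsD1 A) GA in leGn.
- exact: subset_trans (subsetDl _ _) sGF.
- by move=> X /setD1P[_ /leJI].
Qed.

Lemma laminar_indep_augment (I J : {set E}) :
  laminar_indep I -> laminar_indep J -> #|I| < #|J| ->
  exists2 e, e \in J :\: I & laminar_indep (e |: I).
Proof.
move=> /forall_inP iI /forall_inP iJ ltIJ.
apply/exists_inP; apply: contraLR ltIJ => /exists_inPn noe; rewrite -leqNgt.
pose G := [set A in F | #|J :&: A| <= #|I :&: A|].
have leU : #|J :&: cover G| <= #|I :&: cover G|.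
  apply: laminar_cover_card => [|A]; last by rewrite inE => /andP[].
  by apply/subsetP => A; rewrite inE => /andP[].
rewrite -(cardsID (cover G) J) -(cardsID (cover G) I) leq_add //.
apply/subset_leq_card/subsetP => e; rewrite !inE => /andP[ne Je]; rewrite ne /=.
apply: contraNT ne => nIe.
have /noe/forall_inPn[A FA] : e \in J :\: I by rewrite inE nIe.
rewrite -ltnNge => ltA.
have Ae : e \in A.
  apply: contraLR ltA => nAe; rewrite -leqNgt.
  suff -> : (e |: I) :&: A = I :&: A by exact: iI.
  by apply/setP=> x; rewrite !inE; case: eqP => // ->; rewrite (negPf nAe) !andbF.
apply/bigcupP; exists A => //; rewrite inE FA /=.
apply: leq_trans (iJ A FA) _; rewrite -ltnS; apply: leq_trans ltA _.
rewrite setIUl; apply: leq_trans (leq_card_setU _ _) _.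
by rewrite -add1n leq_add2r -(cards1 e) subset_leq_card ?subsetIl.
Qed.

Definition laminar_presentation : matroid E :=
  Matroid laminar_indep0 laminar_indep_sub laminar_indep_augment.

End LaminarMatroid.

Definition laminar (E : finType) (M : matroid E) : Prop :=
  exists (E' : finType) (F : {set {set E'}}) (c : {set E'} -> nat)
         (lamF : laminar_family F),
    matroid_iso M (laminar_presentation c lamF).

(* Main.v *)
Require Import Defs.
From mathcomp Require Import all_boot.

Set Implicit Arguments.
Unset Strict Implicit.
Unset Printing Implicit Defensive.

(** In a laminar presentation a circuit [C] lies in some member [A] of the
    family with [#|C| = c A + 1], hence [C \subset A \subset cl C]; members
    containing intersecting circuits are nested, and so are the closures.
    Conversely, when closures of intersecting circuits are nested, every
    nonloop of [cl C] lies on a circuit with the same closure as [C].  Hence the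
    sets [cl C :\: cl set0] form, together with the set [cl set0] of loops, a
    laminar family, which presents [M] with [rank M] as capacity. *)

Section MatroidTheory.

Context {E : finType} (M : matroid E).
Implicit Types (B C D I X Y Z : {set E}) (e f g : E).

(** * Rank and bases *)

Lemma rank_ge_indep X I : I \subset X -> indep M I -> #|I| <= rank M X.
Proof.
by move=> sIX iI; rewrite /rank (bigmax_sup I) // sIX.
Qed.

Lemma rank_le X n :
  (forall I, I \subset X -> indep M I -> #|I| <= n) -> rank M X <= n.
Proof. by move=> le_n; apply/bigmax_leqP => I /andP[]; apply: le_n. Qed.

Lemma rank_subset X Y : X \subset Y -> rank M X <= rank M Y.
Proof.
move=> sXY; apply: rank_le => I sIX.
by apply: rank_ge_indep; apply: subset_trans sXY.
Qed.

Lemma rank_card X : rank M X <= #|X|.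
Proof. by apply: rank_le => I sIX _; apply: subset_leq_card. Qed.

(** An independent subset of [X] larger than [B] would augment [B] by an element of [X], against
    maximality. *)
Lemma rank_spanning X B : B \subset X -> indep M B ->
  (forall e, e \in X -> e \notin B -> ~~ indep M (e |: B)) ->
  rank M X = #|B|.
Proof.
move=> sBX iB spanB; apply/eqP; rewrite eqn_leq rank_ge_indep // andbT.
apply: rank_le => I sIX iI; rewrite leqNgt.
apply/negP => /(indep_augment iB iI)[e]; rewrite inE => /andP[nBe Ie].
by apply/negP/spanB; rewrite ?(subsetP sIX).
Qed.

Lemma extend_basis X I : I \subset X -> indep M I ->
  exists B, [/\ I \subset B, B \subset X, indep M B & #|B| = rank M X].
Proof.
move=> sIX iI.
have PI : (I \subset X) && indep M I by rewrite sIX.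
have [B /maxsetP[/andP[sBX iB] maxB] sIB] :=
  @maxset_exists _ (fun J => (J \subset X) && indep M J) I PI.
exists B; split=> //; rewrite (@rank_spanning X B) // => e Xe nBe.
apply: contra nBe => ieB; rewrite -(maxB (e |: B)) ?setU11 ?subsetU1 //.
by rewrite ieB andbT subUset sub1set Xe.
Qed.

Lemma basis_exists X :
  exists B, [/\ B \subset X, indep M B & #|B| = rank M X].
Proof.
have [B [_ sBX iB cB]] := extend_basis (sub0set X) (indep0 M).
by exists B.
Qed.

(** * Closure *)

Lemma mem_cl_dep X B e : B \subset X -> #|B| = rank M X ->
  e \in cl M X -> e \notin B -> ~~ indep M (e |: B).
Proof.
move=> sBX cB; rewrite inE => /eqP rX nBe; apply/negP => ieB.
have := rank_ge_indep (setUS [set e] sBX) ieB.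
by rewrite cardsU1 nBe rX cB ltnn.
Qed.

Lemma mem_cl_dependent X e : e \in cl M X -> e \notin X -> ~~ indep M (e |: X).
Proof.
move=> clXe nXe; apply/negP => ieX.
have iX : indep M X by apply: indep_sub ieX; apply: subsetU1.
have rX : #|X| = rank M X.
  by apply/eqP; rewrite eqn_leq rank_card rank_ge_indep.
by have := mem_cl_dep (subxx X) rX clXe nXe; rewrite ieX.
Qed.

Lemma rank_eq_subset_cl X Y : X \subset Y -> rank M Y <= rank M X ->
  Y \subset cl M X.
Proof.
move=> sXY rYX; apply/subsetP => e Ye; rewrite inE eqn_leq.
rewrite [X in _ && X]rank_subset ?subsetU1 // andbT.
by apply: leq_trans rYX; apply: rank_subset; rewrite subUset sub1set Ye.
Qed.

Lemma subset_cl X : X \subset cl M X.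
Proof. exact: rank_eq_subset_cl. Qed.

(** Extend a basis [B] of [X] to a basis [B'] of [Y]. A new element dependent on [B] is dependent on
    [B'], so [B'] stays maximal in [e |: Y]. *)
Lemma cl_mono X Y : X \subset Y -> cl M X \subset cl M Y.
Proof.
move=> sXY; apply/subsetP => e clXe.
have [B [sBX iB cB]] := basis_exists X.
have [B' [sBB' sBY iB' cB']] := extend_basis (subset_trans sBX sXY) iB.
rewrite inE -cB'; apply/eqP/rank_spanning => //.
  exact: subset_trans sBY (subsetU1 _ _).
move=> x; rewrite !inE => /predU1P[-> nBe | Yx nBx].
  have nBe' : e \notin B by apply: contra nBe; apply: (subsetP sBB').
  by apply: contra (mem_cl_dep sBX cB clXe nBe'); apply/indep_sub/setUS.
exact: mem_cl_dep sBY cB' (subsetP (subset_cl Y) _ Yx) nBx.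
Qed.

Lemma rank_setU_cl X Y : Y \subset cl M X -> rank M (X :|: Y) = rank M X.
Proof.
move=> sYX; have [B [sBX iB cB]] := basis_exists X.
rewrite -cB; apply: rank_spanning => //; first exact: subset_trans (subsetUl _ _).
move=> e XYe; apply: mem_cl_dep sBX cB _.
by apply: subsetP XYe; rewrite subUset subset_cl.
Qed.

Lemma rank_cl X : rank M (cl M X) = rank M X.
Proof.
by rewrite -[RHS](rank_setU_cl (subxx (cl M X))) (setUidPr (subset_cl X)).
Qed.

(** [cl M Y] lies in [cl M (X :|: Y)], a superset of [X] of the same rank as [X]. *)
Lemma cl_sub X Y : Y \subset cl M X -> cl M Y \subset cl M X.
Proof.
move=> sYX.
apply: (subset_trans (cl_mono (subsetUr X Y))).
apply: rank_eq_subset_cl; first exact: subset_trans (subsetUl X Y) (subset_cl _).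
by rewrite rank_cl rank_setU_cl.
Qed.

(** * Circuits *)

Lemma circuit_dep C : circuit M C -> ~~ indep M C.
Proof. by move=> /minsetP[]. Qed.

Lemma circuit_proper_indep C I : circuit M C -> I \proper C -> indep M I.
Proof.
move=> /minsetP[_ minC] /properP[sIC [x Cx nIx]]; apply: contraNT nIx => dI.
by rewrite (minC I).
Qed.

Lemma circuitD1_indep C f : circuit M C -> f \in C -> indep M (C :\ f).
Proof. by move=> cC Cf; apply: circuit_proper_indep cC (properD1 Cf). Qed.

Lemma dep_circuit X : ~~ indep M X -> exists2 C, circuit M C & C \subset X.
Proof.
move=> dX; have [C cC sCX] := @minset_exists _ (fun Y => ~~ indep M Y) X dX.
by exists C.
Qed.

Lemma rank_circuitD1 C f : circuit M C -> f \in C -> rank M C = #|C :\ f|.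
Proof.
move=> cC Cf; apply: rank_spanning (subsetDl _ _) (circuitD1_indep cC Cf) _.
move=> e Ce; rewrite !inE Ce andbT negbK => /eqP ->.
by rewrite setD1K //; apply: circuit_dep.
Qed.

Lemma rank_circuit C : circuit M C -> #|C| = (rank M C).+1.
Proof.
move=> cC; have [f Cf] : exists f, f \in C.
  by apply/set0Pn; apply: contraNneq (circuit_dep cC) => ->; apply: indep0.
by rewrite (rank_circuitD1 cC Cf) (cardsD1 f) Cf.
Qed.

Lemma circuit_sub_clD1 C f : circuit M C -> f \in C -> C \subset cl M (C :\ f).
Proof.
move=> cC Cf; apply: rank_eq_subset_cl; first exact: subsetDl.
by rewrite (rank_circuitD1 cC Cf) rank_ge_indep // (circuitD1_indep cC Cf).
Qed.

(** Adding [e] to a basis of [X] creates a circuit; it must use [e], because the basis is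
    independent. *)
Lemma fundamental_circuit X e : e \in cl M X -> e \notin X ->
  exists D, [/\ circuit M D, e \in D & D :\ e \subset X].
Proof.
move=> clXe nXe; have [B [sBX iB cB]] := basis_exists X.
have nBe : e \notin B by apply: contra nXe; apply: subsetP.
have [D cD sDeB] := dep_circuit (mem_cl_dep sBX cB clXe nBe).
have sDB : D :\ e \subset B by rewrite subDset.
exists D; split=> //; last exact: subset_trans sBX.
apply: contraNT (circuit_dep cD) => nDe; apply: indep_sub iB.
by apply: subset_trans sDB; rewrite subsetD1 subxx.
Qed.

(* [D2] is chosen to avoid an element [f] of [D1 :\ e]; then [D1] and [D2]
   cover [C], so the larger of their closures contains [C]. *)
Lemma circuit_through_nonloop C e :
  (forall C1 C2, circuit M C1 -> circuit M C2 ->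
     C1 :&: C2 != set0 -> cl M C1 \subset cl M C2 \/ cl M C2 \subset cl M C1) ->
  circuit M C -> e \in cl M C -> e \notin cl M set0 ->
  exists D, [/\ circuit M D, e \in D & cl M D = cl M C].
Proof.
move=> nested cC clCe nle.
have [Ce | nCe] := boolP (e \in C); first by exists C.
have [D1 [cD1 D1e sD1C]] := fundamental_circuit clCe nCe.
(* If [D1] were just [[set e]], then [e] would be a loop. *)
have [f D1f] : exists f, f \in D1 :\ e.
  apply/set0Pn; apply: contraNneq nle => <-.
  exact: subsetP (circuit_sub_clD1 cD1 D1e) e D1e.
have Cf := subsetP sD1C f D1f.
(* [C :\ f] still spans [C], hence also [e]; this yields a circuit through [e] that avoids [f]. *)
have clCfe := subsetP (cl_sub (circuit_sub_clD1 cC Cf)) e clCe.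
have nCfe : e \notin C :\ f by rewrite inE (negPf nCe) andbF.
have [D2 [cD2 D2e sD2C]] := fundamental_circuit clCfe nCfe.
(* Were [g] missed by both circuits, [C :\ g :\ f] would span [e] through [D2], then [f] through
   [D1], so [C :\ g] would be dependent. *)
have cover_C : C \subset D1 :|: D2.
  apply/subsetP => g Cg; rewrite inE; apply: contraT.
  rewrite negb_or => /andP[nD1g nD2g].
  have [_ {}D1f] := setD1P D1f.
  have neq_fg : f != g by apply: contraNneq nD1g => <-.
  have clCgfe : e \in cl M (C :\ g :\ f).
    have: e \in cl M (D2 :\ e) := subsetP (circuit_sub_clD1 cD2 D2e) e D2e.
    apply/subsetP/cl_mono/subsetP => x D2x.
    have := subsetP sD2C x D2x; move: D2x; rewrite !inE => /andP[_ D2x] /andP[-> ->] /=.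
    by rewrite andbT; apply: contraNneq nD2g => <-.
  have clCgff : f \in cl M (C :\ g :\ f).
    have: f \in cl M (D1 :\ f) := subsetP (circuit_sub_clD1 cD1 D1f) f D1f.
    apply/subsetP/cl_sub/subsetP => x; rewrite in_setD1 => /andP[neq_xf D1x].
    have [-> // | neq_xe] := eqVneq x e.
    apply: (subsetP (subset_cl _)); rewrite !inE neq_xf /=.
    rewrite (subsetP sD1C) ?inE ?neq_xe // andbT.
    by apply: contraNneq nD1g => <-.
  have := mem_cl_dependent clCgff; rewrite setD11 setD1K ?inE ?neq_fg //.
  by rewrite circuitD1_indep // => /(_ isT).
(* The other inclusion is automatic: [D] consists of [e] and elements of [C], all in [cl M C]. *)
have spanning_eq D : circuit M D -> D :\ e \subset C -> C \subset cl M D ->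
    cl M D = cl M C.
  move=> cD sDC sCD; apply/eqP; rewrite eqEsubset !cl_sub // -?subDset.
  apply/subsetP => x Dx; have [-> // | neq_xe] := eqVneq x e.
  by apply: (subsetP (subset_cl C)); rewrite (subsetP sDC) // !inE neq_xe.
have D12 : D1 :&: D2 != set0 by apply/set0Pn; exists e; rewrite inE D1e.
have [le12 | le21] := nested D1 D2 cD1 cD2 D12; [exists D2 | exists D1].
  split=> //; apply: spanning_eq => //.
    exact: subset_trans sD2C (subsetDl _ _).
  apply: subset_trans cover_C _; rewrite subUset subset_cl andbT.
  exact: subset_trans (subset_cl _) le12.
split=> //; apply: spanning_eq => //.
apply: subset_trans cover_C _; rewrite subUset subset_cl /=.
exact: subset_trans (subset_cl _) le21.
Qed.

End MatroidTheory.

(** * Laminar presentations and their circuits *)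

Lemma matroid_iso_id (E : finType) (M M' : matroid E) :
  indep M =1 indep M' -> matroid_iso M M'.
Proof. by move=> eqM; exists id => [|I]; rewrite ?imset_id //; exists id. Qed.

(** Pulling the family and its capacities back along the isomorphism puts the presentation on the
    ground set of [M] itself. *)
Lemma laminar_indepE (E : finType) (M : matroid E) : laminar M ->
  exists (F : {set {set E}}) (c : {set E} -> nat),
    laminar_family F /\ indep M =1 laminar_indep F c.
Proof.
move=> [E' [F [c [lamF [f bij_f indepE]]]]].
have inj_f := bij_inj bij_f; have [g fK gK] := bij_f.
have imK (A : {set E'}) : f @: (f @^-1: A) = A.
  by apply/setP => y; rewrite -(gK y) (mem_imset _ _ inj_f) inE.
exists [set A : {set E} | f @: A \in F], (fun A : {set E} => c (f @: A)); split=> [A B|I].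
  rewrite !inE => FA FB /set0Pn[x /setIP[Ax Bx]].
  have sub_im (X Y : {set E}) : f @: X \subset f @: Y -> X \subset Y.
    move=> sXY; apply/subsetP => y.
    by rewrite -!(mem_imset _ _ inj_f); apply: subsetP.
  have AB : f @: A :&: f @: B != set0.
    by apply/set0Pn; exists (f x); rewrite inE !imset_f.
  by case: (lamF _ _ FA FB AB) => /sub_im; [left | right].
rewrite indepE; apply/forall_inP/forall_inP => iI A.
  by rewrite inE => /iI /=; rewrite -imsetI ?card_imset //; apply: in2W.
move=> FA; have := iI (f @^-1: A); rewrite inE imK => /(_ FA).
by rewrite -(card_imset _ inj_f) imsetI ?imK //; apply: in2W.
Qed.

(** Take a constraint [A] violated by [C]. Deleting an element of [C] outside [A] would leave it
    violated, yet yields an independent set; so [C] lies in [A]. Then [A] has rank at most [c A],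
    which is at most the rank of [C]. *)
Lemma laminar_circuit (E : finType) (M : matroid E) (F : {set {set E}})
    (c : {set E} -> nat) (C : {set E}) :
  indep M =1 laminar_indep F c -> circuit M C ->
  exists2 A, A \in F & C \subset A /\ A \subset cl M C.
Proof.
move=> indepE cC; have := circuit_dep cC; rewrite indepE.
move=> /forall_inPn[A FA]; rewrite -ltnNge => ltA.
have sCA : C \subset A.
  apply/subsetP => x Cx; apply: contraLR ltA => nAx; rewrite -leqNgt.
  have := circuitD1_indep cC Cx; rewrite indepE => /forall_inP/(_ A FA).
  suff -> : (C :\ x) :&: A = C :&: A by [].
  by apply/setP => y; rewrite !inE; case: eqP => // ->; rewrite (negPf nAx) !andbF.
exists A => //; split=> //; apply: (rank_eq_subset_cl sCA).
rewrite (setIidPl sCA) (rank_circuit cC) ltnS in ltA.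
apply: leq_trans ltA; apply: rank_le => I sIA.
by rewrite indepE => /forall_inP/(_ A FA); rewrite (setIidPl sIA).
Qed.

Theorem theorem1p1 (E : finType) (M : matroid E) :
  laminar M <->
  (forall C1 C2 : {set E}, circuit M C1 -> circuit M C2 ->
     C1 :&: C2 != set0 -> cl M C1 \subset cl M C2 \/ cl M C2 \subset cl M C1).
Proof.
split=> [/laminar_indepE[F [c [lamF indepE]]] C1 C2 cC1 cC2 | nested].
  have [A1 FA1 [sC1 sA1]] := laminar_circuit indepE cC1.
  have [A2 FA2 [sC2 sA2]] := laminar_circuit indepE cC2.
  move=> /set0Pn[e /setIP[C1e C2e]].
  have A12 : A1 :&: A2 != set0.
    by apply/set0Pn; exists e; rewrite inE (subsetP sC1) ?(subsetP sC2).
  have [A1A2 | A2A1] := lamF A1 A2 FA1 FA2 A12; [left | right].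
    exact: cl_sub (subset_trans sC1 (subset_trans A1A2 sA2)).
  exact: cl_sub (subset_trans sC2 (subset_trans A2A1 sA1)).
pose L := cl M set0.
(* Every closure contains [L], so with loops present any two closures would meet; hence [L] is
   removed from each. As a member of capacity 0, [L] itself forbids loops. *)
pose F := L |: [set cl M C :\: L | C : {set E} in circuit M].
have lamF : laminar_family F.
  move=> A B /setU1P[-> | /imsetP[C cC ->]] /setU1P[-> | /imsetP[D cD ->]].
  - by left.
  - by rewrite setIDA setDIl setDv set0I eqxx.
  - by rewrite setIC setIDA setDIl setDv set0I eqxx.
  case/set0Pn => e; rewrite !in_setI !in_setD => /andP[/andP[nle Ce] /andP[_ De]].
  (* The closures share the nonloop [e], but [C] and [D] may be disjoint; circuits through [e] with
     the same closures do meet. *)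
  have [C' [cC' C'e <-]] := circuit_through_nonloop nested cC Ce nle.
  have [D' [cD' D'e <-]] := circuit_through_nonloop nested cD De nle.
  have C'D' : C' :&: D' != set0 by apply/set0Pn; exists e; rewrite inE C'e.
  by have [le | le] := nested C' D' cC' cD' C'D'; [left | right]; apply: setSD.
exists E, F, (rank M), lamF; apply: matroid_iso_id => I /=.
apply/idP/forall_inP => [iI A _ | leF].
  by apply: rank_ge_indep; rewrite ?subsetIr //; apply: indep_sub iI; apply: subsetIl.
apply: contraT => /dep_circuit[C cC sCI].
have IL0 : I :&: L = set0.
  apply/eqP; rewrite -cards_eq0 -leqn0; apply: leq_trans (leF L (setU11 _ _)) _.
  by rewrite rank_cl -(@cards0 E) rank_card.
have FC : cl M C :\: L \in F by apply: setU1r; apply: imset_f.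
have sCA : C \subset I :&: (cl M C :\: L).
  apply/subsetP => x Cx; have Ix := subsetP sCI x Cx.
  rewrite !in_setI in_setD Ix (subsetP (subset_cl M C)) // andbT /=.
  by apply/negP => Lx; have := in_set0 x; rewrite -IL0 inE Ix Lx.
(* The constraint of [cl M C :\: L] bounds the size of [C] by the rank of that set, hence by
   [rank M C], which is one less than the size of [C]. *)
have := leq_trans (subset_leq_card sCA) (leF _ FC).
rewrite (rank_circuit cC) ltnNge -(rank_cl M C).
by rewrite rank_subset ?subsetDl.
Qed.
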